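(* Any streaming algorithm that solves \textsc{sink-find-t} in $p$ passes (with error probability at most $1/3$) must use $\Omega(n^{1/p}/p^2)$ space.
   Context: Input: an $n$-vertex tournament presented as a stream of edges in arbitrary (adversarial) order. \textsc{sink-find-t}: under the promise that the input is an acyclic tournament, output a sink (vertex with no outgoing edges). *)

(* Defs.v *)
From mathcomp Require Import all_boot all_order all_algebra.
From mathcomp Require Import reals.

Set Implicit Arguments.
Unset Strict Implicit.
Unset Printing Implicit Defensive.

Import Order.TTheory GRing.Theory Num.Theory.
Local Open Scope ring_scope.

Section Streaming.
Variables (token answer : Type).

(* Only the [s] memory bits carried from one token to the next are charged.
   The pass number and the position within the pass are available for free. *)
Record det_alg (s : nat) := DetAlg {
  init : s.-tuple bool;
  step : nat -> nat -> s.-tuple bool -> token -> s.-tuple bool;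
  out : s.-tuple bool -> answer
}.

Definition run_pass s (A : det_alg s) (stream : seq token)
    (m : s.-tuple bool) (k : nat) : s.-tuple bool :=
  foldl (fun m' ix => step A k ix.1 m' ix.2) m
        (zip (iota 0 (size stream)) stream).

Definition run s (A : det_alg s) (p : nat) (stream : seq token) : answer :=
  out A (foldl (run_pass A stream) (init A) (iota 0 p)).

(* Private coins tossed afresh at each token are covered because [step] may
   depend on the pass and the position: the coin outcome lists all of them.
   For finite token and answer types, a fixed number of passes and streams of
   bounded length, an [s]-bit [det_alg] has only finitely many behaviours, so a
   finite sample space with arbitrary real weights loses no generality. *)
Record rand_alg (R : realType) (s : nat) := RandAlg {
  coins : finType;
  coin_pr : coins -> R;
  coin_pr_ge0 : forall w, 0 <= coin_pr w;
  coin_pr_sum1 : \sum_w coin_pr w = 1;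
  alg_of : coins -> det_alg s
}.

End Streaming.

Section Digraphs.
Variable n : nat.
Implicit Types (e : rel 'I_n) (v : 'I_n).

Definition tournament e : Prop :=
  irreflexive e /\ forall u v, u != v -> e u v (+) e v u.

Definition acyclic e : Prop := forall c : seq 'I_n, cycle e c -> c = [::].

Definition is_sink e v : bool := [forall w, ~~ e v w].

Definition streams_edges e (stream : seq ('I_n * 'I_n)) : Prop :=
  uniq stream /\ forall u v, ((u, v) \in stream) = e u v.

End Digraphs.

Definition error_pr (R : realType) (n s p : nat)
    (A : rand_alg ('I_n * 'I_n) 'I_n R s) (e : rel 'I_n)
    (stream : seq ('I_n * 'I_n)) : R :=
  \sum_(w : coins A | ~~ is_sink e (run (alg_of w) p stream)) coin_pr w.

Definition solves_sink_find_t (R : realType) (n s p : nat)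
    (A : rand_alg ('I_n * 'I_n) 'I_n R s) : Prop :=
  forall (e : rel 'I_n) (stream : seq ('I_n * 'I_n)),
    tournament e -> acyclic e -> streams_edges e stream ->
    error_pr p A e stream <= 3^-1.

(* Main.v *)
Require Import Defs.
From mathcomp Require Import all_boot all_order all_algebra.
From mathcomp Require Import reals sequences exp.
From mathcomp Require Import ring lra zify.

Set Implicit Arguments.
Unset Strict Implicit.
Unset Printing Implicit Defensive.

Import Order.TTheory GRing.Theory Num.Theory.
Local Open Scope ring_scope.

(* Label every node of depth [< p] of the complete [t]-ary tree, [2 t^p <= n],
   by one of its children, and every leaf by a bit. Take the pairs (leaf, bit)
   as vertices and order them lexicographically, the labelled child being the
   closest to the sink at each node: the sink is the leaf reached by following
   the labels from the root, together with its bit. The orientation of an edge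
   only depends on the label of one node, so a stream can present the edges
   decided at depth [p] first, then those decided at depth [p - 1], and so on up
   to the root. A streaming algorithm is then a protocol between [p + 1] players,
   one for each depth, that speak from the bottom to the top in each pass.

   For independent uniform labels, each pass should reveal only one more pointer
   of the path. Let [v] be the node of the path at depth [k], known when pass [k]
   starts (passes are numbered from 0). The players stay independent given the
   transcript, so the label of [v] is independent of what the deeper players say
   before player [k] speaks. If that label were uniform, moving to the child it
   designates would divide by [t] the expected divergence from uniform of the
   labels of each deeper level below the current node, by superadditivity. Hence
   a message of [s] bits by the player at depth [i], sent while the path is known
   down to depth [k < i], costs only [s / t^(i-k)] once the path gets there.
   Pinsker's inequality, in the linear form TV <= 2 lam + KL / lam, bounds the
   price of pretending that the label is uniform. It makes a linear combination
   of the divergences, with weights [lam^-1 / t^(i-k)], a potential for the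
   success probability, which ends up at most
   1/2 + O(p lam) + O(p s / (lam t)); take [lam] of order [1/p]. *)

(** * Divergence from the uniform distribution *)

Section Entropy.
Variable R : realType.

Definition is_dist (Z : finType) (nu : Z -> R) : Prop :=
  (forall z, 0 <= nu z) /\ \sum_z nu z = 1.

Definition push (Z X : finType) (phi : Z -> X) (nu : Z -> R) (x : X) : R :=
  \sum_(z | phi z == x) nu z.

(* Kullback-Leibler divergence from uniform of the law of [phi] under [nu]; the
   junk value [ln 0 = 0] only occurs with weight [0]. *)
Definition KL (Z X : finType) (phi : Z -> X) (nu : Z -> R) : R :=
  \sum_z nu z * ln (push phi nu (phi z) * #|X|%:R).

(** Falling back on [nu] when [m] has probability [0] makes this a distribution for every [m]. *)
Definition cond (Z G : finType) (g : Z -> G) (nu : Z -> R) (m : G) (z : Z) : R :=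
  if push g nu m == 0 then nu z else (g z == m)%:R * nu z / push g nu m.

Lemma eq_KL (Z X : finType) (phi phi' : Z -> X) (nu : Z -> R) :
  phi =1 phi' -> KL phi nu = KL phi' nu.
Proof.
move=> e; apply: eq_bigr => z _; rewrite /push e; congr (_ * ln (_ * _)).
by apply: eq_bigl => y; rewrite e.
Qed.

Lemma sum_push (Z X : finType) (phi : Z -> X) (nu : Z -> R) (f : X -> R) :
  \sum_x push phi nu x * f x = \sum_z nu z * f (phi z).
Proof.
rewrite (partition_big phi predT) //=; apply: eq_bigr => x _.
by rewrite mulr_suml; apply: eq_bigr => z /eqP->.
Qed.

Lemma push_ge0 (Z X : finType) (phi : Z -> X) (nu : Z -> R) x :
  (forall z, 0 <= nu z) -> 0 <= push phi nu x.
Proof. by move=> nu0; apply: sumr_ge0. Qed.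

Lemma le_push (Z X : finType) (phi : Z -> X) (nu : Z -> R) z :
  (forall z, 0 <= nu z) -> nu z <= push phi nu (phi z).
Proof.
by move=> nu0; rewrite /push (bigD1 z) //= lerDl; apply: sumr_ge0.
Qed.

Lemma push_dist (Z X : finType) (phi : Z -> X) (nu : Z -> R) :
  is_dist nu -> is_dist (push phi nu).
Proof.
move=> [nu0 nu1]; split; first by move=> x; apply: push_ge0.
have := sum_push phi nu (fun=> 1).
by under eq_bigr do rewrite mulr1; under [RHS]eq_bigr do rewrite mulr1; rewrite nu1.
Qed.

Lemma mulr_ln_ratio_le (w v : R) :
  0 <= w -> 0 <= v -> (w != 0 -> v != 0) -> w * ln (v / w) <= v - w.
Proof.
move=> w0 v0 wv; have [->|wn0] := eqVneq w 0; first by rewrite mul0r subr0.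
have wp : 0 < w by rewrite lt_def wn0.
have vp : 0 < v by rewrite lt_def wv.
have h : ln (v / w) <= v / w - 1.
  have := @le_ln1Dx R (v / w - 1); rewrite subrKC; apply.
  by have := divr_gt0 vp wp; lra.
apply: le_trans (ler_wpM2l w0 h) _.
by rewrite mulrBr mulr1 mulrCA divff // mulr1.
Qed.

Lemma sum_ln_ratio_le (X : finType) (w v : X -> R) :
  (forall x, 0 <= w x) -> (forall x, 0 <= v x) ->
  (forall x, w x != 0 -> v x != 0) ->
  \sum_x w x * ln (v x / w x) <= \sum_x v x - \sum_x w x.
Proof.
move=> w0 v0 wv; rewrite -sumrB; apply: ler_sum => x _.
exact: mulr_ln_ratio_le (w0 x) (v0 x) (wv x).
Qed.

Lemma condE (Z G : finType) (g : Z -> G) (nu : Z -> R) m z :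
  (forall z, 0 <= nu z) ->
  push g nu m * cond g nu m z = (g z == m)%:R * nu z.
Proof.
move=> nu0; rewrite /cond; case: eqVneq => [w0|wn0]; last first.
  by rewrite mulrC mulfVK.
rewrite w0 mul0r; case: eqVneq => [gz|_]; last by rewrite mul0r.
apply/esym/eqP; rewrite mul1r eq_le nu0 andbT -w0 -gz.
exact: le_push.
Qed.

Lemma cond_dist (Z G : finType) (g : Z -> G) (nu : Z -> R) m :
  is_dist nu -> is_dist (cond g nu m).
Proof.
move=> [nu0 nu1]; rewrite /cond; case: eqVneq => [w0|wn0] //; split.
  by move=> z; rewrite divr_ge0 ?mulr_ge0 ?ler0n ?push_ge0.
rewrite -mulr_suml -[X in X / _ = _](_ : push g nu m = _) ?divff //.
by rewrite /push big_mkcond; apply: eq_bigr => z _; case: eqP; rewrite ?mul1r ?mul0r.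
Qed.

Lemma sum_cond (Z G : finType) (g : Z -> G) (nu : Z -> R) (F : G -> Z -> R) :
  (forall z, 0 <= nu z) ->
  \sum_m push g nu m * (\sum_z cond g nu m z * F m z) =
  \sum_z nu z * F (g z) z.
Proof.
move=> nu0; under eq_bigr => m _.
  rewrite mulr_sumr; under eq_bigr do rewrite mulrA condE //.
  over.
rewrite exchange_big /=; apply: eq_bigr => z _.
rewrite (bigD1 (g z)) //= eqxx mul1r big1 ?addr0 // => m /negbTE.
by rewrite eq_sym => ->; rewrite !mul0r.
Qed.

Lemma entropy_le (G : finType) (w : G -> R) :
  is_dist w -> \sum_m w m * ln (w m)^-1 <= ln #|G|%:R.
Proof.
move=> [w0 w1].
have G0 : (0 < #|G|)%N.
  rewrite lt0n; apply/eqP => /card0_eq G0; move: w1; rewrite big1 => [/eqP|m _].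
    by rewrite eq_sym oner_eq0.
  by have := G0 m; rewrite !inE.
have Gp : 0 < #|G|%:R :> R by rewrite ltr0n.
have Gi : 0 < #|G|%:R^-1 :> R by rewrite invr_gt0.
have G1 : \sum_(m : G) #|G|%:R^-1 = 1 :> R.
  by rewrite sumr_const -[_ *+ _]mulr_natl divff ?gt_eqF.
have := sum_ln_ratio_le w0 (fun=> ltW Gi) (fun _ _ => lt0r_neq0 Gi).
rewrite G1 w1 subrr => h.
have : \sum_m w m * ln (w m)^-1 =
    \sum_m w m * ln (#|G|%:R^-1 / w m) + \sum_m w m * ln #|G|%:R.
  rewrite -big_split; apply: eq_bigr => m _ /=.
  have [->|wn0] := eqVneq (w m) 0; first by rewrite !mul0r addr0.
  have wp : 0 < w m by rewrite lt_def wn0 w0.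
  by rewrite lnM ?posrE ?invr_gt0 // [ln #|G|%:R^-1]lnV ?posrE //; ring.
by rewrite -mulr_suml w1 mul1r => ->; lra.
Qed.

(** Conditioning on [g] raises the probability of [phi z] at most by the factor
    [1 / push g nu (g z)], whose logarithm averages to the entropy of [g]. *)
Lemma KL_cond (Z X G : finType) (phi : Z -> X) (g : Z -> G) (nu : Z -> R) :
  is_dist nu ->
  \sum_m push g nu m * KL phi (cond g nu m) <= KL phi nu + ln #|G|%:R.
Proof.
move=> nud; have [nu0 nu1] := nud; rewrite /KL (sum_cond _ (fun m z => ln _)) //.
apply: le_trans (lerD (lexx _) (entropy_le (push_dist g nud))).
rewrite sum_push -big_split; apply: ler_sum => z _ /=.
have [->|nz] := eqVneq (nu z) 0; first by rewrite !mul0r addr0.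
rewrite -mulrDr ler_wpM2l //.
have np : 0 < nu z by rewrite lt_def nz nu0.
have pp := lt_le_trans np (le_push phi z nu0).
have gp := lt_le_trans np (le_push g z nu0).
have Xp : 0 < #|X|%:R :> R by rewrite ltr0n; apply/card_gt0P; exists (phi z).
have cp : push phi (cond g nu (g z)) (phi z) <= push phi nu (phi z) / push g nu (g z).
  rewrite ler_pdivlMr // mulrC /push mulr_sumr; apply: ler_sum => y _.
  by rewrite condE //; case: eqP => _; rewrite ?mul1r // mul0r.
have c0 : 0 < push phi (cond g nu (g z)) (phi z).
  apply: lt_le_trans (le_push phi z (cond_dist g (g z) nud).1).
  by rewrite /cond gt_eqF // eqxx mul1r divr_gt0.
rewrite -lnM ?posrE ?mulr_gt0 ?invr_gt0 // ler_ln ?posrE ?mulr_gt0 ?invr_gt0 //.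
by rewrite mulrAC ler_pM2r.
Qed.

Lemma ln_prod (I : finType) (F : I -> R) :
  (forall i, 0 < F i) -> ln (\prod_i F i) = \sum_i ln (F i).
Proof.
move=> F0; apply: (@proj1 _ (0 < \prod_i F i)).
elim/big_rec2: _ => [|i y1 y2 _ [y2E y2p]]; first by rewrite ln1.
by rewrite lnM ?posrE // y2E mulr_gt0.
Qed.

(** Superadditivity: the gap is the divergence of the joint law from the product [q] of its
    marginals. *)
Lemma KL_coord (Z I Y : finType) (phi : Z -> {ffun I -> Y}) (nu : Z -> R) :
  is_dist nu ->
  \sum_i KL (fun z => phi z i) nu <= KL phi nu.
Proof.
move=> nud; have [nu0 nu1] := nud; rewrite /KL exchange_big /=.
pose q (x : {ffun I -> Y}) : R := \prod_i push (fun z => phi z i) nu (x i).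
have q0 x : 0 <= q x by apply: prodr_ge0 => i _; apply: push_ge0.
have qp x : push phi nu x != 0 -> q x != 0.
  apply: contra_neq => /eqP; rewrite /q; move/prodf_eq0 => [i _ /eqP pi0].
  apply/eqP; rewrite eq_le push_ge0 // andbT -pi0 /push.
  rewrite [leRHS]big_mkcond [leLHS]big_mkcond; apply: ler_sum => z _.
  by case: eqP => [->|_]; rewrite ?eqxx //; case: ifP.
have q1 : \sum_x q x = 1.
  rewrite /q -(bigA_distr_bigA (fun i => push (fun z => phi z i) nu)) big1 // => i _.
  exact: (push_dist (fun z => phi z i) nud).2.
have := sum_ln_ratio_le (fun x => push_ge0 phi x nu0) q0 qp.
rewrite q1 (push_dist phi nud).2 subrr.
rewrite (sum_push phi nu (fun x => ln (q x / push phi nu x))) => h.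
suff -> : \sum_z \sum_i nu z * ln (push (fun z => phi z i) nu (phi z i) * #|Y|%:R) =
   \sum_z nu z * ln (q (phi z) / push phi nu (phi z)) +
   \sum_z nu z * ln (push phi nu (phi z) * #|{ffun I -> Y}|%:R) by lra.
rewrite -big_split; apply: eq_bigr => z _ /=; rewrite -mulr_sumr -mulrDr.
have [->|nz] := eqVneq (nu z) 0; first by rewrite !mul0r.
congr (_ * _).
have np : 0 < nu z by rewrite lt_def nz nu0.
have pp := lt_le_trans np (le_push phi z nu0).
have pip i := lt_le_trans np (le_push (fun z => phi z i) z nu0).
have Xp : 0 < #|{ffun I -> Y}|%:R :> R.
  by rewrite ltr0n; apply/card_gt0P; exists (phi z).
have qzp : 0 < q (phi z) by rewrite lt_def q0 qp // gt_eqF.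
rewrite -lnM ?posrE ?mulr_gt0 ?invr_gt0 //.
rewrite mulrA mulfVK ?gt_eqF // card_ffun natrX -prodr_const -big_split /=.
rewrite ln_prod // => i; rewrite mulr_gt0 // ltr0n.
by apply/card_gt0P; exists (phi z i).
Qed.

(** [expR y <= 1 / (1 - y)], and [(1 - y) * (1 + y + 2 * y ^+ 2) = 1 + y ^+ 2 * (1 - 2 * y) >=
    1]. *)
Lemma expR_le_quad (y : R) : 0 <= y <= 2^-1 -> expR y <= 1 + y + 2 * y ^+ 2.
Proof.
move=> /andP[y0 y1]; have := expR_ge1Dx (- y); rewrite expRN => h.
have e0 := expR_gt0 y.
have : (1 - y) * expR y <= 1.
  by rewrite -[leRHS](mulVf (lt0r_neq0 e0)) ler_wpM2r // ltW.
nra.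
Qed.

(* Donsker-Varadhan duality: the exponential of [lam * f] is compared with its
   quadratic expansion, which gives the linear form of Pinsker's inequality. *)
Lemma pinsker_linear (Z X : finType) (phi : Z -> X) (nu : Z -> R) (f : X -> R)
    (lam : R) :
  is_dist nu -> 0 < lam <= 2^-1 -> (forall x, 0 <= f x <= 1) ->
  \sum_z nu z * f (phi z) <=
  #|X|%:R^-1 * \sum_x f x + 2 * lam + KL phi nu / lam.
Proof.
move=> nud /andP[l0 l1] f01; have [nu0 nu1] := nud.
have Xp : 0 < #|X|%:R :> R.
  rewrite ltr0n lt0n; apply/eqP => /card0_eq X0; move: nu1; rewrite big1.
    by move/eqP; rewrite eq_sym oner_eq0.
  by move=> z; have := X0 (phi z); rewrite !inE.
have Xi : 0 < #|X|%:R^-1 :> R by rewrite invr_gt0.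
pose v x : R := expR (lam * f x) / #|X|%:R.
have v0 x : 0 < v x by rewrite divr_gt0 ?expR_gt0.
have := sum_ln_ratio_le (fun x => push_ge0 phi x nu0) (fun x => ltW (v0 x))
  (fun x _ => lt0r_neq0 (v0 x)).
rewrite (push_dist phi nud).2 (sum_push phi nu (fun x => ln (v x / push phi nu x))).
have -> : \sum_z nu z * ln (v (phi z) / push phi nu (phi z)) =
    lam * \sum_z nu z * f (phi z) - KL phi nu.
  rewrite mulr_sumr -sumrB; apply: eq_bigr => z _.
  have [->|nz] := eqVneq (nu z) 0; first by rewrite !mul0r mulr0 subr0.
  have np : 0 < nu z by rewrite lt_def nz nu0.
  have pp := lt_le_trans np (le_push phi z nu0).
  have -> : ln (v (phi z) / push phi nu (phi z)) =
      lam * f (phi z) - ln (push phi nu (phi z) * #|X|%:R).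
    rewrite ln_div ?posrE // lnM ?posrE // /v ln_div ?posrE ?expR_gt0 //.
    by rewrite expRK opprD addrA addrAC.
  by rewrite mulrBr mulrCA.
have : \sum_x v x <= 1 + #|X|%:R^-1 * (lam * \sum_x f x) + 2 * lam ^+ 2.
  have -> : 1 + #|X|%:R^-1 * (lam * \sum_x f x) + 2 * lam ^+ 2 =
     \sum_x #|X|%:R^-1 * (1 + lam * f x + 2 * lam ^+ 2).
    have sc (a : R) : \sum_(x : X) a = #|X|%:R * a by rewrite sumr_const mulr_natl.
    rewrite -mulr_sumr !big_split /= -mulr_sumr !sc.
    by field; rewrite gt_eqF.
  apply: ler_sum => x _; rewrite /v mulrC ler_pM2l //.
  have /andP[f0 f1] := f01 x.
  apply: le_trans (expR_le_quad _) _.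
    by rewrite mulr_ge0 ?(ltW l0) //= (le_trans _ l1) // ler_piMr // ltW.
  by rewrite exprMn lerD2l ler_pM2l // ler_piMr ?sqr_ge0 // expr_le1.
move=> h1 h2; rewrite -(ler_pM2l l0) !mulrDr [lam * (_ / lam)]mulrC mulfVK ?gt_eqF //.
rewrite [lam * (_^-1 * _)]mulrCA; lra.
Qed.

End Entropy.

(** * Pointer chasing on a tree *)

Section Levels.
Variables (R : realType) (I : finType).

(* Labellings of the depth-[j] nodes of the [I]-ary tree, as nested functions. *)
Fixpoint lvl (L : finType) (j : nat) : finType :=
  if j is j'.+1 then {ffun I -> lvl L j'} else L.

Fixpoint restrict (L : finType) (j : nat) (f : seq I -> L) : lvl L j :=
  if j is j'.+1 return lvl L j
  then [ffun i => restrict j' (fun s => f (i :: s))] else f [::].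

Lemma eq_restrict (L : finType) j (f f' : seq I -> L) :
  f =1 f' -> restrict j f = restrict j f'.
Proof.
elim: j f f' => [|j IH] f f' ff' /=; first exact: ff'.
by apply/ffunP => i; rewrite !ffunE; apply: IH => s; apply: ff'.
Qed.

Definition KL_below (Z L : finType) (lb : Z -> seq I -> L) (d : nat) (v : seq I)
    (nu : Z -> R) : R :=
  KL (fun z => restrict d (fun s => lb z (v ++ s))) nu.

Lemma KL_below_child (Z L : finType) (lb : Z -> seq I -> L) d v (nu : Z -> R) :
  is_dist nu ->
  \sum_i KL_below lb d (rcons v i) nu <= KL_below lb d.+1 v nu.
Proof.
move=> nud; apply: le_trans (KL_coord _ nud); apply: ler_sum => i _.
rewrite le_eqVlt; apply/orP; left; apply/eqP; apply: eq_KL => z /=.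
by rewrite ffunE; apply: eq_restrict => s; rewrite cat_rcons.
Qed.

End Levels.

(** * The game between the players and its potential *)

Section Game.
Variables (R : realType) (I Z M : finType) (p : nat).
Variables (st : nat -> nat -> M -> Z -> M) (out : M -> bool).
Variables (lab : Z -> seq I -> I) (bit : Z -> seq I -> bool).

Local Notation inputs := {ffun 'I_p.+1 -> Z}.

Fixpoint run_players (k j : nat) (m : M) (z : inputs) : M :=
  if j is j'.+1 then run_players k j' (st k j' m (z (inord j'))) z else m.

(* [cont r k m v z]: starting pass [k] in state [m], with [r] passes to go and
   the pointers followed down to the node [v] at depth [k], the algorithm ends
   up guessing the bit of the leaf that the pointers lead to. *)
Fixpoint cont (r k : nat) (m : M) (v : seq I) (z : inputs) : bool :=
  if r is r'.+1 then
    cont r' k.+1 (run_players k p.+1 m z) (rcons v (lab (z (inord k)) v)) z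
  else out m == bit (z (inord k)) v.

(** Probability of [F] when the players draw independent inputs from the laws [nu i]. *)
Definition Val (F : inputs -> bool) (nu : 'I_p.+1 -> Z -> R) : R :=
  \sum_(z : inputs) (\prod_i nu i (z i)) * (F z)%:R.

Definition upd (nu : 'I_p.+1 -> Z -> R) (j : 'I_p.+1) (w : Z -> R) :=
  fun i => if i == j then w else nu i.

Lemma upd_dist nu j w :
  (forall i, is_dist (nu i)) -> is_dist w -> forall i, is_dist (upd nu j w i).
Proof. by move=> nud wd i; rewrite /upd; case: eqP. Qed.

(** Total probability over [g (z j)]: conditioning a product law on one coordinate keeps it a
    product law and changes only [nu j]. *)
Lemma Val_split (G : finType) (g : Z -> G) (j : 'I_p.+1) nu (F : inputs -> bool)
    (FG : G -> inputs -> bool) :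
  (forall i, is_dist (nu i)) -> (forall z, F z = FG (g (z j)) z) ->
  Val F nu = \sum_m push g (nu j) m * Val (FG m) (upd nu j (cond g (nu j) m)).
Proof.
move=> nud FE; rewrite /Val; under [RHS]eq_bigr do rewrite mulr_sumr.
rewrite exchange_big /=; apply: eq_bigr => z _.
have E m : push g (nu j) m *
    ((\prod_i upd nu j (cond g (nu j) m) i (z i)) * (FG m z)%:R) =
    (g (z j) == m)%:R * ((\prod_i nu i (z i)) * (FG m z)%:R).
  rewrite (bigD1 j) //= [in RHS](bigD1 j) //= {1}/upd eqxx !mulrA condE.
    2: exact: (nud j).1.
  do 2! congr (_ * _).
  by apply: eq_bigr => i ij; rewrite /upd (negbTE ij).
rewrite (eq_bigr _ (fun m _ => E m)).
rewrite (bigD1 (g (z j))) //= eqxx mul1r [X in _ + X]big1 ?addr0 -?FE // => m.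
by rewrite eq_sym => /negbTE ->; rewrite mul0r.
Qed.

Lemma Val_true nu : (forall i, is_dist (nu i)) -> Val (fun=> true) nu = 1.
Proof.
move=> nud; rewrite /Val; under eq_bigr do rewrite mulr1.
by rewrite -bigA_distr_bigA big1 // => i _; apply: (nud i).2.
Qed.

Lemma Val_false nu : Val (fun=> false) nu = 0.
Proof. by rewrite /Val big1 // => z _; rewrite mulr0. Qed.

Lemma Val_ge0 F nu : (forall i, is_dist (nu i)) -> 0 <= Val F nu.
Proof.
move=> nud; apply: sumr_ge0 => z _; rewrite mulr_ge0 ?ler0n // prodr_ge0 // => i _.
exact: (nud i).1.
Qed.

Lemma Val_le1 F nu : (forall i, is_dist (nu i)) -> Val F nu <= 1.
Proof.
move=> nud; rewrite -(Val_true nud); apply: ler_sum => z _.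
rewrite ler_wpM2l ?ler_nat ?leq_b1 // prodr_ge0 // => i _.
exact: (nud i).1.
Qed.

Variables (lam C : R).
Hypotheses (lam01 : 0 < lam <= 2^-1) (I_gt0 : (0 < #|I|)%N).

Definition weight (d : nat) : R := lam^-1 / #|I|%:R ^+ d.

Hypothesis sum_weight :
  forall D, (D <= p)%N -> \sum_(1 <= d < D.+1) weight d <= C.

Lemma weight_ge0 d : 0 <= weight d.
Proof.
by have /andP[l0 _] := lam01; rewrite divr_ge0 ?invr_ge0 ?exprn_ge0 ?ler0n // ltW.
Qed.

Lemma weightS d : weight d.+1 = #|I|%:R^-1 * weight d.
Proof. by rewrite /weight exprS invfM mulrCA. Qed.

Definition kl (i d : nat) (v : seq I) (nu : Z -> R) : R :=
  if i == p then KL_below bit d v nu else KL_below lab d v nu.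

Lemma kl_child i d v nu :
  is_dist nu -> \sum_x kl i d (rcons v x) nu <= kl i d.+1 v nu.
Proof. by rewrite /kl; case: eqP => _; apply: KL_below_child. Qed.

Lemma kl_cond (G : finType) (g : Z -> G) i d v nu : is_dist nu ->
  \sum_m push g nu m * kl i d v (cond g nu m) <= kl i d v nu + ln #|G|%:R.
Proof. by rewrite /kl; case: eqP => _; apply: KL_cond. Qed.

Definition potential (k : nat) (v : seq I) (nu : 'I_p.+1 -> Z -> R) : R :=
  \sum_(k <= i < p.+1) weight (i - k) * kl i (i - k) v (nu (inord i)).

Lemma potential_upd_lt k v nu j w :
  (j < k)%N -> (k <= p.+1)%N -> potential k v (upd nu (inord j) w) = potential k v nu.
Proof.
move=> jk kp; apply: eq_big_nat => i ki; congr (_ * kl _ _ _ _).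
rewrite /upd -val_eqE /= !inordK; [by case: eqP => //; lia|lia..].
Qed.

Lemma potential_cond (G : finType) (g : Z -> G) k v nu j :
  (forall i, is_dist (nu i)) -> (k <= j <= p)%N ->
  \sum_m push g (nu (inord j)) m *
     potential k v (upd nu (inord j) (cond g (nu (inord j)) m)) <=
  potential k v nu + weight (j - k) * ln #|G|%:R.
Proof.
move=> nud kj; under eq_bigr do rewrite mulr_sumr.
rewrite exchange_big /=.
have -> : weight (j - k) * ln #|G|%:R =
    \sum_(k <= i < p.+1) (if i == j then weight (i - k) * ln #|G|%:R else 0).
  by rewrite -big_mkcond big_nat1_eq ltnS kj.
rewrite -big_split; apply: ler_sum_nat => i ki /=.
case: eqP => [->|/eqP ij].
  under eq_bigr do rewrite /upd eqxx mulrCA.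
  by rewrite -mulr_sumr -mulrDr ler_wpM2l ?weight_ge0 // kl_cond.
rewrite addr0; under eq_bigr => m _.
  rewrite /upd -val_eqE /= !inordK ?(negbTE ij); [|lia..].
  over.
by rewrite -mulr_suml (push_dist _ (nud _)).2 mul1r.
Qed.

Let S : R := ln #|M|%:R.

(** [2^-1 + 2 * lam] pays for guessing the final bit; each pass adds [2 * lam] for treating one
    label as uniform and [C * S] for the messages. *)
Definition bound (r : nat) : R := 2^-1 + 2 * lam + r%:R * (2 * lam + C * S).

Lemma sum_push_cst (G : finType) (g : Z -> G) nu (a : R) :
  is_dist nu -> \sum_m push g nu m * a = a.
Proof. by move=> nud; rewrite -mulr_suml (push_dist g nud).2 mul1r. Qed.

(* The players above depth [k] are heard for free: the potential no longer
   involves their inputs. *)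
Lemma Val_after r k j m v nu :
  (forall m v nu, (forall i, is_dist (nu i)) ->
     Val (cont r k.+1 m v) nu <= bound r + potential k.+1 v nu) ->
  (k < p)%N -> (j <= k)%N -> (forall i, is_dist (nu i)) ->
  Val (fun z => cont r k.+1 (run_players k j m z) v z) nu <=
  bound r + potential k.+1 v nu.
Proof.
move=> IH kp; elim: j m nu => [|j IHj] m nu jk nud; first exact: IH.
rewrite (Val_split (FG := fun m' z => cont r k.+1 (run_players k j m' z) v z)
  (g := st k j m) (j := inord j)) //.
rewrite -[leRHS](sum_push_cst (st k j m) _ (nud (inord j))).
apply: ler_sum => m' _; rewrite ler_wpM2l ?push_ge0 //; first exact: (nud _).1.
rewrite -(@potential_upd_lt k.+1 v nu j (cond (st k j m) (nu (inord j)) m')); [|lia..].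
apply: IHj; first lia.
exact: upd_dist nud (cond_dist _ _ (nud _)).
Qed.

(** The label and the message of player [k] are conditioned on together, and the rest is bounded by
    a function of the label alone. Making the label uniform costs [2 * lam] and the term [i = k] of
    the potential; averaging over the children then yields at most the terms [i > k]. *)
Lemma Val_reveal r k m v nu :
  (forall m v nu, (forall i, is_dist (nu i)) ->
     Val (cont r k.+1 m v) nu <= bound r + potential k.+1 v nu) ->
  (k < p)%N -> (forall i, is_dist (nu i)) ->
  Val (fun z => cont r k.+1 (run_players k k.+1 m z)
                  (rcons v (lab (z (inord k)) v)) z) nu <=
  bound r + 2 * lam + potential k v nu.
Proof.
move=> IH kp nud; set kk : 'I_p.+1 := inord k.
pose g y := (lab y v, st k k m y).
(* Capped at [1] to suit [pinsker_linear]; it is nonnegative because [IH] makes it dominate a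
   probability. *)
pose f l : R := Num.min 1 (bound r + potential k.+1 (rcons v l) nu).
rewrite (Val_split (g := g) (j := kk)
  (FG := fun lm z => cont r k.+1 (run_players k k lm.2 z) (rcons v lm.1) z)) //.
have nuc lm i : is_dist (upd nu kk (cond g (nu kk) lm) i).
  exact: upd_dist nud (cond_dist _ _ (nud _)) i.
apply: (@le_trans _ _ (\sum_lm push g (nu kk) lm * f lm.1)).
  apply: ler_sum => lm _; rewrite ler_wpM2l ?push_ge0 //; first exact: (nud _).1.
  rewrite /f le_min Val_le1 //=.
  rewrite -(@potential_upd_lt k.+1 _ nu k (cond g (nu kk) lm)); [|lia..].
  exact: Val_after.
rewrite (sum_push g (nu kk) (fun lm => f lm.1)) /=.
apply: le_trans (pinsker_linear (fun y => lab y v) (nud _) lam01 _) _.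
  move=> l; rewrite /f le_min ler01 /= ge_min lexx /= andbT.
  exact: le_trans (Val_ge0 (cont r k.+1 m (rcons v l)) nud) (IH _ _ _ nud).
rewrite /potential big_ltn; last lia.
have -> : weight (k - k) * kl k (k - k) v (nu (inord k)) =
    KL (fun y => lab y v) (nu kk) / lam.
  rewrite subnn /weight expr0 divr1 mulrC; congr (_ * _).
  rewrite /kl; case: eqP => [?|_]; first lia.
  by apply: eq_KL => y /=; rewrite cats0.
set P := \sum_(_ <= i < _) _.
suff : #|I|%:R^-1 * \sum_x f x <= bound r + P by lra.
have Ip : 0 < #|I|%:R :> R by rewrite ltr0n.
apply: (@le_trans _ _ (#|I|%:R^-1 *
   \sum_x (bound r + potential k.+1 (rcons v x) nu))).
  rewrite ler_wpM2l ?invr_ge0 ?ler0n //; apply: ler_sum => x _.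
  by rewrite /f ge_min lexx orbT.
rewrite big_split /= mulrDr sumr_const -[bound r *+ _]mulr_natl mulKf ?gt_eqF //.
rewrite lerD2l /potential exchange_big /= mulr_sumr /P; apply: ler_sum_nat => i ki.
rewrite -mulr_sumr mulrA -weightS (_ : (i - k.+1).+1 = i - k)%N; last lia.
rewrite ler_wpM2l ?weight_ge0 //; apply: le_trans (kl_child _ _ _ (nud _)) _.
by rewrite (_ : (i - k.+1).+1 = i - k)%N //; lia.
Qed.

(* A message of the player at depth [i > k] costs [S] in the divergence of that
   player only, which weighs [weight (i - k)] as long as the pointer at depth
   [k] has not been revealed. *)
Lemma Val_before r k j m v nu :
  (forall m v nu, (forall i, is_dist (nu i)) ->
     Val (cont r k.+1 m v) nu <= bound r + potential k.+1 v nu) ->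
  (k < p)%N -> (k < j <= p.+1)%N -> (forall i, is_dist (nu i)) ->
  Val (fun z => cont r k.+1 (run_players k j m z)
                  (rcons v (lab (z (inord k)) v)) z) nu <=
  bound r + 2 * lam + (\sum_(k.+1 <= i < j) weight (i - k)) * S + potential k v nu.
Proof.
move=> IH kp; elim: j m nu => [|j IHj] m nu kj nud; first lia.
have [jk|] := eqVneq j k.
  rewrite jk big_geq // mul0r addr0; exact: Val_reveal.
move=> jk; rewrite (Val_split (g := st k j m) (j := inord j)
  (FG := fun m' z => cont r k.+1 (run_players k j m' z)
                       (rcons v (lab (z (inord k)) v)) z)) //.
set sj := \sum_(_ <= i < j.+1) _.
pose nu' m' := upd nu (inord j) (cond (st k j m) (nu (inord j)) m').
set s' := \sum_(k.+1 <= i < j) weight (i - k).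
have sjE : sj = s' + weight (j - k) by rewrite /sj big_nat_recr //; lia.
apply: (@le_trans _ _ (\sum_m' push (st k j m) (nu (inord j)) m' *
   (bound r + 2 * lam + s' * S + potential k v (nu' m')))).
  apply: ler_sum => m' _; rewrite ler_wpM2l ?push_ge0 //; first exact: (nud _).1.
  apply: IHj; first lia.
  exact: upd_dist nud (cond_dist _ _ (nud _)).
under eq_bigr do rewrite mulrDr.
rewrite big_split /= sum_push_cst // sjE mulrDl.
have := @potential_cond _ (st k j m) k v nu j nud; rewrite -/S /nu' => h.
have {}h := h ltac:(lia); lra.
Qed.

Lemma Val_cont r k m v nu :
  (k + r = p)%N -> 0 <= S -> (forall i, is_dist (nu i)) ->
  Val (cont r k m v) nu <= bound r + potential k v nu.
Proof.
move=> + S0; elim: r k m v nu => [|r IH] k m v nu kr nud.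
  (* At a leaf only the bit of player [p] matters; any guess of a uniform bit is right with
     probability [2^-1]. *)
  rewrite /= (Val_split (g := fun y => bit y v) (j := inord k)
    (FG := fun b z => out m == b)) //.
  pose f b : R := (out m == b)%:R.
  rewrite (_ : \sum__ _ = \sum_b push (fun y => bit y v) (nu (inord k)) b * f b);
      last first.
    apply: eq_bigr => b _; congr (_ * _); rewrite /f; case: eqP => _.
      rewrite Val_true //; exact: upd_dist nud (cond_dist _ _ (nud _)).
    by rewrite Val_false.
  rewrite sum_push; apply: le_trans (pinsker_linear _ (nud _) lam01 _) _.
    by move=> b; rewrite /f ler0n lern1 leq_b1.
  rewrite card_bool big_bool /f /bound mul0r addr0 /potential.
  rewrite big_ltn; last lia.
  rewrite [\sum_(_ <= i < _) _]big_geq; last lia.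
  rewrite addr0 subnn /kl /weight expr0 divr1 mulrC.
  have -> : (k == p) by apply/eqP; lia.
  have -> : KL_below bit 0 v (nu (inord k)) = KL (fun y => bit y v) (nu (inord k)).
    by apply: eq_KL => y /=; rewrite cats0.
  rewrite [lam^-1 * _]mulrC; case: (out m) => /=; lra.
have kp : (k < p)%N by lia.
apply: le_trans (Val_before m v _ kp _ nud) _; [|lia|].
  by move=> m' v' nu' nud'; apply: IH => //; lia.
rewrite lerD2r /bound -natr1 mulrDl mul1r.
have : (\sum_(k.+1 <= i < p.+1) weight (i - k)) * S <= C * S.
  rewrite ler_wpM2r //; have := @sum_weight (p - k) (leq_subr _ _).
  rewrite -[k.+1]add1n big_addn subSn; last lia.
  by under [X in _ -> X <= _]eq_bigr do rewrite addnK.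
lra.
Qed.

End Game.

(** * Independent uniform labels, with initial potential zero *)

Section UniformInputs.
Variables (R : realType) (I : finType) (i0 : I) (p : nat).

Fixpoint eval_lvl (L : finType) (j : nat) : lvl I L j -> seq I -> L :=
  if j is j'.+1 return lvl I L j -> seq I -> L
  then fun y w => eval_lvl (y (head i0 w)) (behead w) else fun y _ => y.

Lemma restrict_eval (L : finType) j (y : lvl I L j) : restrict j (eval_lvl y) = y.
Proof. by elim: j y => //= j IH y; apply/ffunP => i; rewrite ffunE; apply: IH. Qed.

Lemma card_lvl_gt0 (L : finType) j : (0 < #|L|)%N -> (0 < #|lvl I L j|)%N.
Proof. by move=> L0; elim: j => //= j IH; rewrite card_ffun expn_gt0 IH. Qed.

Definition unif (Y : finType) : Y -> R := fun=> #|Y|%:R^-1.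

Lemma unif_dist (Y : finType) : (0 < #|Y|)%N -> is_dist (@unif Y).
Proof.
move=> Y0; split=> [y|]; first by rewrite invr_ge0 ler0n.
by rewrite sumr_const -[_ *+ _]mulr_natl divff // pnatr_eq0 -lt0n.
Qed.

Lemma KL_unif (Z Y : finType) (sec : Y -> Z) (phi : Z -> Y) :
  (0 < #|Y|)%N -> cancel sec phi -> KL phi (push sec (@unif Y)) = 0.
Proof.
move=> Y0 secK; rewrite /KL big1 // => z _.
have -> : push phi (push sec (@unif Y)) (phi z) = #|Y|%:R^-1.
  have -> nu : push phi nu (phi z) = \sum_z' nu z' * (phi z' == phi z)%:R.
    rewrite /push big_mkcond; apply: eq_bigr => z' _.
    by case: eqP; rewrite ?mulr1 ?mulr0.
  rewrite (sum_push sec (@unif Y) (fun z' => (phi z' == phi z)%:R)).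
  rewrite (bigD1 (phi z)) //= secK eqxx mulr1 big1 ?addr0 // => y /negbTE.
  by rewrite secK => ->; rewrite mulr0.
by rewrite mulVf ?ln1 ?mulr0 // pnatr_eq0 -lt0n.
Qed.

(** One type serves all players: the labels of one level on the left, the leaf bits on the right. *)
Definition input : finType := ({i : 'I_p.+1 & lvl I I i} + lvl I bool p)%type.

Definition input_lab (z : input) (w : seq I) : I :=
  if z is inl u then eval_lvl (tagged u) w else i0.

Definition input_bit (z : input) (w : seq I) : bool :=
  if z is inr y then eval_lvl y w else false.

Definition input_law (i : 'I_p.+1) : input -> R :=
  if i == p :> nat then push (fun y : lvl I bool p => inr y) (@unif _)
  else push (fun y : lvl I I i => inl (Tagged (fun i : 'I_p.+1 => lvl I I i) y)) (@unif _).

Lemma I_gt0 : (0 < #|I|)%N. Proof. by apply/card_gt0P; exists i0. Qed.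

Lemma input_law_dist i : is_dist (input_law i).
Proof.
rewrite /input_law; case: eqP => _; apply: push_dist; apply: unif_dist;
  apply: card_lvl_gt0; [by rewrite card_bool|exact: I_gt0].
Qed.

Lemma kl_input (i : 'I_p.+1) : kl p input_lab input_bit i i [::] (input_law i) = 0.
Proof.
rewrite /kl /input_law; case: eqP => [->|_].
  apply: KL_unif => [|y /=]; last exact: restrict_eval.
  by apply: card_lvl_gt0; rewrite card_bool.
apply: KL_unif => [|y /=]; last exact: restrict_eval.
by apply: card_lvl_gt0; exact: I_gt0.
Qed.

Lemma potential_input (lam : R) :
  potential input_lab input_bit lam 0 [::] input_law = 0.
Proof.
rewrite /potential big_nat big1 // => i /andP[_ ip].
have := kl_input (inord i); rewrite !inordK // subn0 => ->.
by rewrite mulr0.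
Qed.

End UniformInputs.

(** * Tournaments from labelled trees *)

Section LexOrder.

(* The child [d = l] comes first, that is, closest to the sink. *)
Definition rank (l d : nat) : nat := if d == l then 0 else d.+1.

(** [beats L a b] stands for an edge from [a] to [b]: where they branch, [b] takes the child closer
    to the sink. *)
Fixpoint beats (L : seq nat -> nat) (a b : seq nat) : bool :=
  match a, b with
  | x :: a', y :: b' => (rank (L [::]) y < rank (L [::]) x)%N ||
      (x == y) && beats (fun s => L (x :: s)) a' b'
  | _, _ => false
  end.

Fixpoint lcp (a b : seq nat) : nat :=
  match a, b with
  | x :: a', y :: b' => if x == y then (lcp a' b').+1 else 0
  | _, _ => 0
  end.

Lemma rank_inj l : injective (rank l).
Proof. by move=> x y; rewrite /rank; do 2 case: eqP => //; lia. Qed.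

Lemma beats_irr L a : beats L a a = false.
Proof. by elim: a L => //= x a IH L; rewrite ltnn eqxx IH. Qed.

Lemma beats_trans L b a c : beats L a b -> beats L b c -> beats L a c.
Proof.
elim: b L a c => [|y b IH] L [|x a] [|z c] //= /orP[xy|/andP[/eqP-> ab]]
  /orP[yz|/andP[/eqP yz bc]].
- by rewrite (ltn_trans yz xy).
- by rewrite -yz xy.
- by rewrite yz.
by rewrite -yz eqxx (IH _ _ _ ab) ?orbT.
Qed.

Lemma beats_total L a b : size a = size b -> a != b -> beats L a b (+) beats L b a.
Proof.
elim: a b L => [|x a IH] [|y b] //= L [sab]; rewrite eqseq_cons.
case: (eqVneq x y) => [<-|xy] /= ab; first by rewrite ltnn /=; apply: IH.
have : rank (L [::]) x != rank (L [::]) y by rewrite (inj_eq (@rank_inj _)).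
by rewrite !orbF; case: ltngtP.
Qed.

(** Only the label of the node where the words branch is consulted. This is what lets a stream group
    its edges by depth. *)
Lemma eq_beats L L' a b :
  (forall w, size w = lcp a b -> L w = L' w) -> beats L a b = beats L' a b.
Proof.
elim: a b L L' => [|x a IH] [|y b] //= L L'; case: (eqVneq x y) => [-> LL'|_ LL'].
  by rewrite !ltnn /=; apply: IH => w sw; apply: LL'; rewrite /= sw.
by rewrite !orbF LL'.
Qed.

Lemma lcpC a b : lcp a b = lcp b a.
Proof.
elim: a b => [|x a IH] [|y b] //=; rewrite eq_sym.
by case: eqP => // _; rewrite IH.
Qed.

Lemma lcp_lt a b : size a = size b -> a != b -> (lcp a b < size a)%N.
Proof.
elim: a b => [|x a IH] [|y b] //= [sab]; rewrite eqseq_cons.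
by case: eqP => //= _ ab; rewrite ltnS IH.
Qed.

(** Where [a] first leaves [c], the word [c] takes the labelled child, of minimal rank [0]. *)
Lemma beats_path L a c :
  size a = size c -> a != c ->
  (forall i, (i < size c)%N -> nth 0 c i = L (take i c))%N -> beats L a c.
Proof.
elim: a c L => [|x a IH] [|y c] //= L [sac]; rewrite eqseq_cons.
case: (eqVneq x y) => [->|xy] /= ac Lc; last first.
  by rewrite orbF /rank -(Lc 0%N) //= eqxx (negbTE xy).
rewrite ltnn /=; apply: IH => // i ic; exact: (Lc i.+1).
Qed.

End LexOrder.

(* Vertices that do not code a leaf of the [t.+1]-ary tree get a first digit
   larger than all labels. *)
Lemma vertex_digits (n t p : nat) : (0 < p)%N -> (2 * t.+1 ^ p <= n)%N ->
  exists dig : 'I_n -> seq nat,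
    [/\ forall x, size (dig x) = p.+1, injective dig &
        forall (v : seq 'I_t.+1) (b : bool), size v = p ->
          exists x, dig x = rcons (map val v) b].
Proof.
move=> p0 np; pose T := (p.-tuple 'I_t.+1 * bool)%type.
have Tn : (#|{: T}| <= n)%N.
  by rewrite card_prod card_tuple card_ord card_bool mulnC.
pose emb (u : T) : 'I_n := widen_ord Tn (enum_rank u).
have emb_inj : injective emb.
  move=> u u' /(congr1 val) /= h; apply: enum_rank_inj; exact: val_inj.
pose code (u : T) : seq nat := rcons (map val u.1) u.2.
exists (fun x => if [pick u | emb u == x] is Some u then code u
                 else (t.+1 + x)%N :: nseq p 0%N); split.
- move=> x; case: pickP => [u _|_] /=; last by rewrite size_nseq.
  by rewrite /code size_rcons size_map size_tuple.
- have big (u : T) x s : code u != (t.+1 + x)%N :: s.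
    apply/eqP; case: u => [[[|i v] /= sv] b]; first by exfalso; move: p0; rewrite -(eqP sv).
    by rewrite /code /= => -[] h _; have := ltn_ord i; lia.
  move=> x x'; case: pickP => [u /eqP <-|_]; case: pickP => [u' /eqP <-|_].
  + rewrite /code => /rcons_inj [h1 h2]; congr emb; apply: injective_projections.
      by apply: val_inj; apply: inj_map h1; apply: val_inj.
    by move: h2; case: u.2; case: u'.2.
  + by move/eqP; rewrite (negbTE (big _ _ _)).
  + by move/esym/eqP; rewrite (negbTE (big _ _ _)).
  + move=> /(congr1 (head 0%N)) /= h; apply/val_inj/eqP; by rewrite -(eqn_add2l t.+1) h.
- move=> v b /eqP sv; exists (emb (Tuple sv, b)).
  case: pickP => [u /eqP/emb_inj -> //|/(_ (Tuple sv, b))]; by rewrite eqxx.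
Qed.

Section Reduction.
Variables (n p t : nat) (Z : finType).
Variables (lab : Z -> seq 'I_t.+1 -> 'I_t.+1) (bit : Z -> seq 'I_t.+1 -> bool).
Variable dig : 'I_n -> seq nat.
Hypothesis size_dig : forall x, size (dig x) = p.+1.
Hypothesis dig_inj : injective dig.
Hypothesis dig_surj : forall (v : seq 'I_t.+1) (b : bool), size v = p ->
  exists x, dig x = rcons (map val v) b.

Local Notation inputs := {ffun 'I_p.+1 -> Z}.

(** A leaf's bit acts as the label for the last digit. On digits that are not labels [inord] takes a
    default value, harmless since every labelling gives an acyclic tournament. *)
Definition level_label (y : Z) (i : nat) (w : seq nat) : nat :=
  if i == p then nat_of_bool (bit y (map inord w)) else lab y (map inord w).

Definition labels (z : inputs) (w : seq nat) : nat :=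
  level_label (z (inord (size w))) (size w) w.

Definition edge (z : inputs) : rel 'I_n :=
  fun u v => beats (labels z) (dig u) (dig v).

Lemma edge_total z u v : u != v -> edge z u v (+) edge z v u.
Proof. by move=> uv; apply: beats_total; rewrite ?size_dig // (inj_eq dig_inj). Qed.

Lemma edge_tournament z : tournament (edge z).
Proof. by split=> [u|u v]; [exact: beats_irr|exact: edge_total]. Qed.

Lemma edge_acyclic z : acyclic (edge z).
Proof.
case=> [//|x c] /= h.
have tr : transitive (edge z) by move=> a b d; apply: beats_trans.
have := order_path_min tr h; rewrite all_rcons => /andP[].
by rewrite /edge beats_irr.
Qed.

Fixpoint pointers (k : nat) (z : inputs) : seq 'I_t.+1 :=
  if k is k'.+1 then rcons (pointers k' z) (lab (z (inord k')) (pointers k' z))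
  else [::].

Lemma size_pointers k z : size (pointers k z) = k.
Proof. by elim: k => //= k IH; rewrite size_rcons IH. Qed.

Lemma take_pointers i k z : (i <= k)%N -> take i (pointers k z) = pointers i z.
Proof.
elim: k => [|k IH]; first by rewrite leqn0 => /eqP ->.
rewrite leq_eqVlt => /orP[/eqP ->|]; first by rewrite take_oversize ?size_pointers.
rewrite ltnS => ik /=; rewrite -cats1 takel_cat ?size_pointers //; exact: IH.
Qed.

(** By [beats_path], every other vertex has an edge to the end of the path. *)
Lemma pointers_sink z x : is_sink (edge z) x ->
  dig x = rcons (map val (pointers p z)) (bit (z (inord p)) (pointers p z)).
Proof.
move=> /forallP xs; set b := bit _ _.
have [y dy] := dig_surj b (size_pointers p z).
rewrite -dy; apply/eqP; case: (eqVneq (dig x) (dig y)) => // xy.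
have := xs y; rewrite /edge beats_path ?size_dig // => i ip.
have val_inord (v : seq 'I_t.+1) : map inord (map val v) = v.
  by rewrite -map_comp (eq_map (@inord_val _)) map_id.
rewrite dy -cats1 takel_cat ?size_map ?size_pointers // -map_take.
rewrite take_pointers // /labels /level_label size_map size_pointers val_inord.
rewrite nth_cat size_map size_pointers.
case: (eqVneq i p) => [->|ip']; first by rewrite ltnn subnn.
have lt_ip : (i < p)%N by rewrite ltn_neqAle ip'.
rewrite lt_ip (nth_map ord0) ?size_pointers //; congr val.
rewrite -(nth_take (n0 := i.+1)) // take_pointers //=.
by rewrite nth_rcons size_pointers ltnn eqxx.
Qed.

(** Independent of the labels, so block lengths and token positions are the same for all inputs. *)
Definition pairs (i : nat) : seq ('I_n * 'I_n) :=
  [seq q : 'I_n * 'I_n <- enum {: 'I_n * 'I_n} |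
    (q.1 < q.2)%N && (lcp (dig q.1) (dig q.2) == i)].

Definition orient (i : nat) (y : Z) (q : 'I_n * 'I_n) : 'I_n * 'I_n :=
  if beats (level_label y i) (dig q.1) (dig q.2) then q else (q.2, q.1).

Definition block (i : nat) (y : Z) : seq ('I_n * 'I_n) := map (orient i y) (pairs i).

Fixpoint blocks (j : nat) (z : inputs) : seq ('I_n * 'I_n) :=
  if j is j'.+1 then block j' (z (inord j')) ++ blocks j' z else [::].

Lemma edge_level z u v :
  edge z u v = beats (level_label (z (inord (lcp (dig u) (dig v))))
                        (lcp (dig u) (dig v))) (dig u) (dig v).
Proof. by apply: eq_beats => w sw; rewrite /labels sw. Qed.

Lemma mem_block i (z : inputs) u v :
  ((u, v) \in block i (z (inord i))) = edge z u v && (lcp (dig u) (dig v) == i).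
Proof.
apply/mapP/andP => [[[a b]]|[uv /eqP lci]].
  rewrite mem_filter /= => /andP[/andP[ab /eqP <-] _]; rewrite /orient -edge_level /=.
  case: ifP => [eab [-> ->]|eab [-> ->]]; first by rewrite eab eqxx.
  split; last by rewrite lcpC.
  have := @edge_total z a b; rewrite eab /= => -> //.
  by apply: contraTneq ab => ->; rewrite ltnn.
have nuv : u != v by apply: contraTneq uv => ->; rewrite /edge beats_irr.
have evu : edge z v u = false.
  by have := edge_total z nuv; rewrite uv /=; case: edge.
case: (ltngtP u v) => [lt|lt|/val_inj e]; last by rewrite e eqxx in nuv.
  exists (u, v); first by rewrite mem_filter /= lt lci eqxx mem_enum.
  by rewrite /orient -lci -edge_level uv.
exists (v, u); first by rewrite mem_filter /= lt lcpC lci eqxx mem_enum.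
by rewrite /orient -lci lcpC -edge_level evu.
Qed.

Lemma mem_blocks j z u v :
  ((u, v) \in blocks j z) = edge z u v && (lcp (dig u) (dig v) < j)%N.
Proof.
elim: j => [|j IH] /=; first by rewrite ltn0 andbF.
by rewrite mem_cat mem_block IH -andb_orr ltnS [in RHS]leq_eqVlt.
Qed.

Lemma block_uniq i y : uniq (block i y).
Proof.
rewrite map_inj_in_uniq ?filter_uniq -?enumT ?enum_uniq // => -[a b] [c d].
rewrite !mem_filter /= => /andP[/andP[ab _] _] /andP[/andP[cd _] _].
rewrite /orient /=; case: ifP => _; case: ifP => _ [] //.
- by move=> -> ->.
- by move=> ad bc; move: ab cd; rewrite ad bc; lia.
- by move=> bc ad; move: ab cd; rewrite bc ad; lia.
by move=> -> ->.
Qed.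

Lemma blocks_uniq j z : uniq (blocks j z).
Proof.
elim: j => //= j IH; rewrite cat_uniq block_uniq IH andbT /=.
apply/hasPn => -[u v]; rewrite mem_blocks mem_block => /andP[_ lt].
by rewrite (ltn_eqF lt) andbF.
Qed.

Lemma blocks_stream z : streams_edges (edge z) (blocks p.+1 z).
Proof.
split=> [|u v]; first exact: blocks_uniq.
rewrite mem_blocks; have [->|uv] := eqVneq u v; first by rewrite /edge beats_irr.
by rewrite -(size_dig u) lcp_lt ?andbT // ?size_dig // (inj_eq dig_inj).
Qed.

(** * A pass over the stream as a round of the game *)

Section Protocol.
Variables (s : nat) (A : det_alg ('I_n * 'I_n) 'I_n s).

(** Position in the stream where [blocks j] starts, after the deeper blocks; [step] depends on
    it. *)
Definition offset (j : nat) : nat := \sum_(j <= l < p.+1) size (pairs l).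

Definition block_step (k i : nat) (m : s.-tuple bool) (y : Z) : s.-tuple bool :=
  foldl (fun m' ix => step A k ix.1 m' ix.2) m
        (zip (iota (offset i.+1) (size (pairs i))) (block i y)).

Definition guess (m : s.-tuple bool) : bool := odd (last 0%N (dig (out A m))).

Lemma run_blocks k j m (z : inputs) : (j <= p.+1)%N ->
  foldl (fun m' ix => step A k ix.1 m' ix.2) m
        (zip (iota (offset j) (size (blocks j z))) (blocks j z)) =
  run_players block_step k j m z.
Proof.
elim: j m => [|j IH] m jp //=; rewrite size_cat iotaD zip_cat ?size_iota //.
rewrite foldl_cat /= -IH; last exact: ltnW.
rewrite /block_step size_map; congr (foldl _ _ (zip (iota _ _) _)).
by rewrite {2}/offset big_ltn // addnC.
Qed.

Lemma run_passes r k m (z : inputs) :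
  cont block_step guess lab bit r k m (pointers k z) z =
  (guess (foldl (run_pass A (blocks p.+1 z)) m (iota k r)) ==
   bit (z (inord (k + r))) (pointers (k + r) z)).
Proof.
elim: r k m => [|r IH] k m; first by rewrite /= addn0.
have e : run_pass A (blocks p.+1 z) m k = run_players block_step k p.+1 m z.
  by rewrite -run_blocks // /offset big_geq.
rewrite -[LHS]/(cont block_step guess lab bit r k.+1
  (run_players block_step k p.+1 m z) (pointers k.+1 z) z).
by rewrite IH addSnnS -e.
Qed.

(** The last digit of the sink is the bit of the leaf reached, so a correct output wins the game. *)
Lemma sink_cont (z : inputs) :
  is_sink (edge z) (run A p (blocks p.+1 z)) ->
  cont block_step guess lab bit p 0 (init A) [::] z.
Proof.
move/pointers_sink => h; rewrite -[[::]]/(pointers 0 z) run_passes add0n /guess.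
by rewrite -/(run A p _) h last_rcons oddb.
Qed.

End Protocol.
End Reduction.

(** * The space bound *)

(** Average over labels and coins: for each labelling the algorithm succeeds with probability at
    least [1 - 3^-1], while each coin outcome fixes a protocol that [Val_cont] bounds, starting from
    potential [0]. *)
Lemma sink_find_bound (R : realType) (n p s t : nat)
    (A : rand_alg ('I_n * 'I_n) 'I_n R s) (lam C : R) :
  (0 < p)%N -> (2 * t.+1 ^ p <= n)%N -> solves_sink_find_t p A ->
  0 < lam <= 2^-1 ->
  (forall D, (D <= p)%N -> \sum_(1 <= d < D.+1) weight 'I_t.+1 lam d <= C) ->
  1 - 3^-1 <= bound {: s.-tuple bool} lam C p.
Proof.
move=> p0 np solA lam01 sumC.
have [dig [size_dig dig_inj dig_surj]] := vertex_digits p0 np.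
pose I : finType := 'I_t.+1.
pose lab := @input_lab I ord0 p; pose bit := @input_bit I ord0 p.
pose nu := @input_law R I p.
have nud : forall i, is_dist (nu i) by apply: input_law_dist; exact: ord0.
pose F (w : coins A) (z : {ffun 'I_p.+1 -> input I p}) :=
  cont (block_step p lab bit dig (alg_of w)) (guess dig (alg_of w)) lab bit
  p 0 (init (alg_of w)) [::] z.
have S0 : 0 <= ln #|{: s.-tuple bool}|%:R :> R.
  by rewrite ln_ge0 // card_tuple card_bool natrX exprn_ege1 // ler1n.
have ValF (w : coins A) : Val (F w) nu <= bound {: s.-tuple bool} lam C p.
  have := @Val_cont R I _ _ p (block_step p lab bit dig (alg_of w)) (guess dig (alg_of w))
    lab bit lam C lam01 (I_gt0 ord0) sumC p 0 (init (alg_of w)) [::] nu (add0n p) S0 nud.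
  by rewrite potential_input addr0.
apply: (@le_trans _ _ (\sum_w coin_pr w * Val (F w) nu)); last first.
  rewrite -[leRHS]mul1r -(coin_pr_sum1 A) mulr_suml; apply: ler_sum => w _.
  by rewrite ler_wpM2l ?coin_pr_ge0.
under eq_bigr do rewrite mulr_sumr.
rewrite exchange_big /=.
have <- : Val (fun=> true) nu * (1 - 3^-1) = 1 - 3^-1 by rewrite Val_true // mul1r.
rewrite mulr_suml.
apply: ler_sum => z _; rewrite mulr1.
under [leRHS]eq_bigr do rewrite mulrCA.
rewrite -mulr_sumr ler_wpM2l //.
  by apply: prodr_ge0 => i _; apply: (nud i).1.
have := solA _ _ (edge_tournament lab bit size_dig dig_inj z)
  (edge_acyclic (lab := lab) (bit := bit) (dig := dig) (z := z))
  (blocks_stream lab bit size_dig dig_inj z).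
rewrite /error_pr => err; rewrite lerBlDr.
apply: le_trans (lerD (lexx _) err).
rewrite -[leLHS](coin_pr_sum1 A) [X in _ + X]big_mkcond -big_split /=.
apply: ler_sum => w _; case: ifPn => [_|].
  by rewrite lerDr mulr_ge0 ?coin_pr_ge0 ?ler0n.
rewrite negbK => /(sink_cont size_dig dig_surj) sc.
by rewrite /F sc mulr1 addr0.
Qed.

Lemma sum_weight_le (R : realType) (t D : nat) (lam : R) : 0 < lam ->
  \sum_(1 <= d < D.+1) weight 'I_t.+2 lam d <= lam^-1 * (2 / t.+2%:R).
Proof.
move=> l0; rewrite /weight -mulr_sumr ler_pM2l ?invr_gt0 // card_ord.
set T : R := t.+2%:R.
have T2 : 2 <= T by rewrite ler_nat.
(* The remainder [2 / T ^+ D.+1] strengthens the claim so that induction works for [T >= 2]. *)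
suff : \sum_(1 <= d < D.+1) (T ^+ d)^-1 + 2 / T ^+ D.+1 <= 2 / T.
  by apply: le_trans; rewrite lerDl divr_ge0 // exprn_ge0 // ler0n.
elim: D => [|D IH]; first by rewrite big_geq // add0r expr1.
rewrite big_nat_recr //=; apply: le_trans IH; rewrite -addrA lerD2l.
have -> : (T ^+ D.+2)^-1 = T^-1 * (T ^+ D.+1)^-1 by rewrite exprS invfM.
set x := (T ^+ D.+1)^-1.
have x0 : 0 <= x by rewrite invr_ge0 exprn_ge0 // ler0n.
have : T^-1 <= 2^-1 by rewrite lef_pV2 ?posrE; lra.
by move: x x0 (T^-1) => x x0 y h; nra.
Qed.

(** As [2 <= 2 ^ p], the factor [2] can be moved inside the power. *)
Lemma root_le_arity (R : realType) (n p T : nat) :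
  (0 < p)%N -> (n <= 2 * T.+1 ^ p)%N -> powR (n%:R : R) p%:R^-1 <= 2 * T.+1%:R.
Proof.
move=> p0 nT; have p0R : p%:R != 0 :> R by rewrite pnatr_eq0 -lt0n.
have x0 : 0 <= 2 * T.+1%:R :> R by rewrite mulr_ge0 ?ler0n.
have <- : powR ((2 * T.+1%:R) ^+ p) p%:R^-1 = 2 * T.+1%:R :> R.
  by rewrite -powR_mulrn // -powRrM divff // powRr1.
apply: ge0_ler_powR; rewrite ?invr_ge0 ?nnegrE ?ler0n ?exprn_ge0 //.
rewrite exprMn -!natrX -natrM ler_nat (leq_trans nT) // leq_mul2r.
by rewrite -{1}[2%N]expn1 leq_exp2l // p0 orbT.
Qed.

Lemma max_arity (n p : nat) : (0 < p)%N -> (2 <= n)%N ->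
  exists t : nat, (2 * t.+1 ^ p <= n)%N /\ (n <= 2 * t.+2 ^ p)%N.
Proof.
move=> p0 n2; have exT : exists t, (2 * t.+1 ^ p <= n)%N.
  by exists 0%N; rewrite exp1n.
have ubT t : (2 * t.+1 ^ p <= n)%N -> (t <= n)%N.
  move=> h; have : (t.+1 ^ 1 <= t.+1 ^ p)%N by rewrite leq_pexp2l.
  by rewrite expn1; lia.
case: (ex_maxnP exT ubT) => t ht tmax; exists t; split=> //.
by case: (leqP n (2 * t.+2 ^ p)) => // /ltnW /tmax; rewrite ltnn.
Qed.

Theorem theorem4p3 (R : realType) :
  exists (c : R) (n0 : nat), 0 < c /\
    forall n p s : nat, (n0 <= n)%N -> (1 <= p)%N ->
    forall A : rand_alg ('I_n * 'I_n) 'I_n R s,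
      solves_sink_find_t p A ->
      c * (powR n%:R (p%:R^-1) / p%:R ^+ 2) <= s%:R.
Proof.
(* [3456 = 3 * 1152]: for arity [T >= 2], the proof gets [T <= 1152 * p ^+ 2 * s], and the root of
   [n] is at most [2 * (T + 1) <= 3 * T]. *)
exists 3456^-1, 2%N; split; first by rewrite invr_gt0 ltr0n.
move=> n p s n2 p1 A solA.
have [t [tn nt]] := max_arity p1 n2.
have root := root_le_arity R p1 nt.
have P1 : 1 <= p%:R :> R by rewrite ler1n.
have S_le : ln #|{: s.-tuple bool}|%:R <= s%:R :> R.
  rewrite card_tuple card_bool natrX lnXn ?ltr0n // -[leRHS]mulr1 mulr_natl ler_wMn2r //.
  by have := @le_ln1Dx R 1 ltac:(lra).
(* All the [2 * lam] terms sum to [1/12], half of the advantage [2/3 - 1/2]; the messages must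
   supply the other half. *)
pose lam : R := (24 * (p%:R + 1))^-1.
have lamV : lam^-1 = 24 * (p%:R + 1) by rewrite invrK.
have l0 : 0 < lam by rewrite invr_gt0; lra.
have lamE : lam * (p%:R + 1) = 24^-1 by rewrite /lam; field; lra.
clearbody lam; have lam01 : 0 < lam <= 2^-1 by rewrite l0 /=; nra.
have := @sink_find_bound R n p s t A lam _ p1 tn solA lam01.
rewrite /bound; set S := ln _ in S_le * => main.
suff : powR n%:R p%:R^-1 <= 3456 * s%:R * p%:R ^+ 2 :> R.
  by rewrite ler_pdivrMl ?ltr0n // ler_pdivrMr ?exprn_gt0 ?ltr0n.
(* With arity [1] the weights do not decay, but the root of [n] is at most [4], so [s >= 1]
   suffices; [s = 0] would give [2/3 <= 1/2 + 1/12]. *)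
case: t tn nt root main => [|t] tn nt root main.
  have [s0|s0] := eqVneq s 0%N.
    have sumC D : (D <= p)%N ->
        \sum_(1 <= d < D.+1) weight 'I_1 lam d <= p%:R * lam^-1.
      move=> Dp; rewrite /weight card_ord.
      under eq_bigr do rewrite expr1n divr1.
      rewrite sumr_const_nat subn1 -[_^-1 *+ _]mulr_natl.
      by apply: ler_wpM2r; [rewrite invr_ge0 ltW|rewrite ler_nat].
    have := main _ sumC.
    have -> : S = 0 by rewrite /S card_tuple s0 expn0 ln1.
    nra.
  have s1 : 1 <= s%:R :> R by rewrite ler1n lt0n.
  nra.
have := main _ (fun D _ => @sum_weight_le R t D lam l0).
rewrite lamV.
rewrite -(@natr1 R t.+2) in root; set T : R := t.+2%:R in root *.
have T2 : 2 <= T by rewrite ler_nat.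
set P : R := p%:R in P1 lamE root *; move=> h.
clearbody P T; have {}h : 12^-1 <= P * (24 * (P + 1) * (2 / T) * S) by lra.
have : T <= 576 * P * (P + 1) * S.
  have -> : 576 * P * (P + 1) * S = 12 * T * (P * (24 * (P + 1) * (2 / T) * S)).
    by field; lra.
  have := ler_wpM2l (_ : 0 <= 12 * T) h; lra.
have : P * (P + 1) * S <= 2 * P ^+ 2 * s%:R.
  have s0 : 0 <= s%:R :> R by rewrite ler0n.
  apply: (@le_trans _ _ (P * (P + 1) * s%:R)).
    by rewrite ler_wpM2l //; nra.
  by rewrite ler_wpM2r //; nra.
lra.
Qed.
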